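(* Let $M\in\mathbb{R}^{n\times n}$, let $B:\mathbb{R}^n\rightrightarrows\mathbb{R}^n$ be a set-valued operator, and let $A=M\circ B$. Suppose that $(B,\mathrm{id})\in\mathcal{M}_0$. (i) If $M$ is nonsingular, then $(A,cM^{-\top})\in\mathcal{M}_0$ for any $c>0$. (ii) If $\operatorname{rank}(M)=n-1$, then $(A,yx^\top)\in\mathcal{M}_0$ for some $x,y\in\mathbb{R}^n\setminus\{0\}$.
   Context: For set-valued $A:\mathbb{R}^n\rightrightarrows\mathbb{R}^n$, $\operatorname{gph}A=\{(x,u):u\in A(x)\}$; $(M\circ B)(x)=\{Mu:u\in B(x)\}$; matrices are identified with the (single-valued) linear maps they define. $\mathrm{id}$ is the identity operator and $\langle\cdot,\cdot\rangle$ the Euclidean inner product. $\mathcal{M}_0$ is the class of monotone operator pairs: $(A,B)\in\mathcal{M}_0$ iff $\langle u_A-\bar u_A,u_B-\bar u_B\rangle\geq0$ for all $(x,u_A),(\bar x,\bar u_A)\in\operatorname{gph}A$ and $(x,u_B),(\bar x,\bar u_B)\in\operatorname{gph}B$. In particular $(B,\mathrm{id})\in\mathcal{M}_0$ means that $B$ is monotone in the classical sense. *)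

(* Defs.v *)
From mathcomp Require Import all_boot all_order all_algebra.
From mathcomp Require Import classical_sets reals.

Set Implicit Arguments.
Unset Strict Implicit.
Unset Printing Implicit Defensive.

Import Order.TTheory GRing.Theory Num.Theory.
Local Open Scope classical_set_scope.
Local Open Scope ring_scope.

(* Set-valued operators R^n => R^n, on column vectors. *)
Definition setop (R : realType) (n : nat) : Type := 'cV[R]_n -> set 'cV[R]_n.

Definition gph (R : realType) (n : nat) (A : setop R n) :
    set ('cV[R]_n * 'cV[R]_n) :=
  [set p | A p.1 p.2].

Definition inner (R : realType) (n : nat) (u v : 'cV[R]_n) : R :=
  \sum_(i < n) u i 0 * v i 0.

Definition single_valued (R : realType) (n : nat)
    (f : 'cV[R]_n -> 'cV[R]_n) : setop R n :=
  fun x => [set f x].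

Definition id_op (R : realType) (n : nat) : setop R n := single_valued idfun.
Arguments id_op : clear implicits.

Definition mx_op (R : realType) (n : nat) (M : 'M[R]_n) : setop R n :=
  single_valued (fun x => M *m x).

Definition mx_comp (R : realType) (n : nat) (M : 'M[R]_n) (B : setop R n) :
    setop R n :=
  fun x => [set M *m u | u in B x].

(* The class M_0: the base points x, xb are shared by A and B. *)
Definition monotone_pairs (R : realType) (n : nat) :
    set (setop R n * setop R n) :=
  [set AB | forall x uA xb uAb uB uBb : 'cV[R]_n,
     gph AB.1 (x, uA) -> gph AB.1 (xb, uAb) ->
     gph AB.2 (x, uB) -> gph AB.2 (xb, uBb) ->
     0 <= inner (uA - uAb) (uB - uBb)].

(* Main.v *)
Require Import Defs.
From mathcomp Require Import all_boot all_order all_algebra.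
From mathcomp Require Import classical_sets reals.

Import Order.TTheory GRing.Theory Num.Theory.
Local Open Scope classical_set_scope.
Local Open Scope ring_scope.

(** By adjunction, the pairing of [M *m (u - ub)] with [N *m (x - xb)] equals that of [u - ub] with
    [M^T *m N *m (x - xb)]. In (i), [N] is chosen so that [M^T *m N] is [c] times the identity,
    leaving [c] times the monotonicity inequality of [B]. In (ii), [y] is a nonzero vector of the
    kernel of [M^T], so [M^T *m (y *m x^T)] vanishes and the pairing is 0. *)

Lemma innerE (R : realType) (n : nat) (u v : 'cV[R]_n) :
  inner u v = (u^T *m v) 0 0.
Proof. by rewrite mxE; apply: eq_bigr => i _; rewrite mxE. Qed.

Lemma inner_mulmxl (R : realType) (n : nat) (M : 'M[R]_n) (u v : 'cV[R]_n) :
  inner (M *m u) v = inner u (M^T *m v).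
Proof. by rewrite !innerE trmx_mul mulmxA. Qed.

Lemma innerZr (R : realType) (n : nat) (c : R) (u v : 'cV[R]_n) :
  inner u (c *: v) = c * inner u v.
Proof. by rewrite !innerE -scalemxAr mxE. Qed.

Lemma inner0r (R : realType) (n : nat) (u : 'cV[R]_n) : inner u 0 = 0.
Proof. by rewrite innerE mulmx0 mxE. Qed.

(* Moving M to the other side of the inner product reduces the pair
   (M o B, N) to the matrix M^T N acting on differences of base points. *)
Lemma monotone_pairs_mx_comp (R : realType) (n : nat) (M N : 'M[R]_n)
    (B : setop R n) :
  (forall x u xb ub, B x u -> B xb ub ->
     0 <= inner (u - ub) (M^T *m N *m (x - xb))) ->
  monotone_pairs (mx_comp M B, mx_op N).
Proof.
move=> H x w xb wb v vb [u Bu wE] [ub Bub wbE] vE vbE.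
rewrite -(wE : M *m u = w) -(wbE : M *m ub = wb).
rewrite (vE : v = N *m x) (vbE : vb = N *m xb).
by rewrite -!mulmxBr inner_mulmxl mulmxA; apply: H.
Qed.

(** [kermx M] is the left kernel, spanned by rows [v] with [v *m M = 0]; a nonzero one, transposed,
    is the required column. *)
Lemma exists_kermx_trmx (R : fieldType) (n : nat) (M : 'M[R]_n) :
  (\rank M < n)%N -> exists2 y : 'cV[R]_n, y != 0 & M^T *m y = 0.
Proof.
move=> rkM; have /rowV0Pn [v /sub_kermxP vM v0] : kermx M != 0.
  by rewrite kermx_eq0 /row_free ltn_eqF.
exists v^T; last by rewrite -trmx_mul vM trmx0.
by apply: contra v0 => /eqP vT0; rewrite -[v]trmxK vT0 trmx0.
Qed.

Theorem mainTheorem8 (R : realType) (n : nat) (M : 'M[R]_n) (A B : setop R n)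
    (hA : A = mx_comp M B) (hB : monotone_pairs (B, id_op R n)) :
  (M \in unitmx ->
     forall c : R, 0 < c -> monotone_pairs (A, mx_op (c *: (invmx M)^T))) /\
  ((\rank M + 1)%N = n ->
     exists x y : 'cV[R]_n,
       [/\ x != 0, y != 0 & monotone_pairs (A, mx_op (y *m x^T))]).
Proof.
rewrite {}hA; split=> [uM c c0|rkM].
  apply: monotone_pairs_mx_comp => x u xb ub Bu Bub.
  rewrite -scalemxAr -trmx_mul mulVmx // trmx1 -scalemxAl mul1mx innerZr.
  apply: mulr_ge0; first exact: ltW.
  (* The values of [id_op] are the base points themselves. *)
  exact: (hB x u xb ub x xb).
have [|y y0 My] := @exists_kermx_trmx _ _ M; first by move: rkM; rewrite addn1 => ->.
(* Any nonzero [x] would do, since [y] alone makes the product vanish; [y] is a nonzero vector at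
   hand. *)
exists y, y; split=> //; apply: monotone_pairs_mx_comp => x u xb ub _ _.
by rewrite mulmxA My !mul0mx inner0r.
Qed.
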